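(* Let $n\ge p\ge 1$, let $x_1,\ldots,x_n\in\mathbb{R}^p$ be fixed vectors such that $\Sigma_n=n^{-1}\sum_{i=1}^n x_ix_i^{\rm t}$ has full rank, and let $y_i=x_i^{\rm t}\beta+\varepsilon_i$ for $i=1,\ldots,n$, with $\beta\in\mathbb{R}^p$ and $\varepsilon_1,\ldots,\varepsilon_n$ i.i.d. $N(0,\sigma^2)$, $\sigma>0$. Let $x_0\in\mathbb{R}^p$ be nonzero, $\mu=x_0^{\rm t}\beta$, and let $S$ be a subset of $\{1,\ldots,p\}$. Let ${\rm mse}_S={\rm E}\,(\hat\mu_S-\mu)^2$ and ${\rm mse}_{\rm wide}={\rm E}\,(\hat\mu_{\rm wide}-\mu)^2$. Then the relative risk is $${\rm rr}_S=\frac{{\rm mse}_S}{{\rm mse}_{\rm wide}}=\frac{x_{0,S}^{\rm t}\Sigma_{n,S}^{-1}x_{0,S}+n\lambda_S^2}{x_0^{\rm t}\Sigma_n^{-1}x_0},\qquad \lambda_S=\omega_S^{\rm t}\beta_{S^c}/\sigma.$$ In particular, ${\rm mse}_S<{\rm mse}_{\rm wide}$ if and only if $$|\lambda_S|<(x_0^{\rm t}\Sigma_n^{-1}x_0-x_{0,S}^{\rm t}\Sigma_{n,S}^{-1}x_{0,S})^{1/2}/\sqrt n=(\omega_S^{\rm t}Q_S\omega_S)^{1/2}/\sqrt n .$$ Moreover, if $\omega_S\ne0$ and $\kappa_S=\sqrt n\,\omega_S^{\rm t}\beta_{S^c}/\{(\omega_S^{\rm t}Q_S\omega_S)^{1/2}\sigma\}$,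 then $${\rm rr}_S=\frac{x_{0,S}^{\rm t}\Sigma_{n,S}^{-1}x_{0,S}+\omega_S^{\rm t}Q_S\omega_S\,\kappa_S^2}{x_0^{\rm t}\Sigma_n^{-1}x_0}=1-\frac{\omega_S^{\rm t}Q_S\omega_S}{x_0^{\rm t}\Sigma_n^{-1}x_0}(1-\kappa_S^2).$$
   Context: For $u\in\mathbb{R}^p$ and $S\subseteq\{1,\ldots,p\}$, $u_S$ denotes the subvector of entries $u_j$ with $j\in S$, and $S^c$ is the complement of $S$. The matrix $\Sigma_n$ is blocked according to indices inside $S$ (block index 0) and outside $S$ (block index 1): $\Sigma_{00,S}$ is the submatrix with rows and columns in $S$, $\Sigma_{01,S}$ has rows in $S$ and columns in $S^c$, $\Sigma_{10,S}=\Sigma_{01,S}^{\rm t}$, and $\Sigma_{11,S}$ has rows and columns in $S^c$. Write $\Sigma_{n,S}=\Sigma_{00,S}$. The submodel least squares estimator is $\hat\beta_S=\Sigma_{n,S}^{-1}n^{-1}\sum_{i=1}^n x_{i,S}y_i$, and $\hat\mu_S=x_{0,S}^{\rm t}\hat\beta_S$. The wide model estimators are $\hat\beta_{\rm wide}=\Sigma_n^{-1}n^{-1}\sum_{i=1}^n x_iy_i$ and $\hat\mu_{\rm wide}=x_0^{\rm t}\hat\beta_{\rm wide}$. Also $\omega_S=\Sigma_{10,S}\Sigma_{00,S}^{-1}x_{0,S}-x_{0,S^c}$ and $Q_S=(\Sigma_{11,S}-\Sigma_{10,S}\Sigma_{00,S}^{-1}\Sigma_{01,S})^{-1}$. Terms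 involving empty index sets are read as zero. All expectations are under the full model $y_i=x_i^{\rm t}\beta+\varepsilon_i$. *)

(* Defs.v *)
From HB Require Import structures.
From mathcomp Require Import all_boot all_order all_algebra.
From mathcomp Require Import all_classical all_reals all_analysis.

Set Implicit Arguments.
Unset Strict Implicit.
Unset Printing Implicit Defensive.

Import Order.TTheory GRing.Theory Num.Theory.
Import numFieldNormedType.Exports.

Local Open Scope classical_set_scope.
Local Open Scope ring_scope.

Definition mutually_independent d (T : measurableType d) (R : realType)
    (P : probability T R) (n : nat) (X : 'I_n -> {RV P >-> R}) : Prop :=
  forall (J : {set 'I_n}) (B : 'I_n -> set R),
    (forall i, measurable (B i)) ->
    P (\bigcap_(i in [set` J]) (X i @^-1` B i)) =
    (\prod_(i in J) P (X i @^-1` B i))%E.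

(* The second parameter of [normal_prob] is the standard deviation. *)
Definition iid_normal d (T : measurableType d) (R : realType)
    (P : probability T R) (n : nat) (m s : R) (X : 'I_n -> {RV P >-> R})
    : Prop :=
  mutually_independent X /\
  forall (i : 'I_n) (B : set R), measurable B ->
    distribution P (X i) B = normal_prob m s B.

Section LinearAlgebra.
Variables (R : realType) (p : nat).
Implicit Types (u : 'cV[R]_p) (M : 'M[R]_p) (S U : {set 'I_p}).

Definition dotv k (u v : 'cV[R]_k) : R := (u^T *m v) 0 0.

Definition bilin k (u : 'cV[R]_k) (M : 'M[R]_k) (v : 'cV[R]_k) : R :=
  dotv u (M *m v).

(* The elements of S are listed by [enum_val : 'I_#|S| -> 'I_p], so that all
   these have dimension #|S|, which may be 0; every sum over an empty index
   set is then 0. *)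
Definition subv S u : 'cV[R]_#|S| := rowsub (@enum_val _ (mem S)) u.

Definition blkmx S U M : 'M[R]_(#|S|, #|U|) :=
  mxsub (@enum_val _ (mem S)) (@enum_val _ (mem U)) M.

End LinearAlgebra.

Section Regression.
Variables (R : realType) (n p : nat) (x : 'I_n -> 'cV[R]_p).
Implicit Types (S : {set 'I_p}) (beta : 'cV[R]_p) (y : 'I_n -> R).

Definition Sigma : 'M[R]_p := n%:R^-1 *: \sum_(i < n) x i *m (x i)^T.

Definition Sigma00 S := blkmx S S Sigma.
Definition Sigma01 S := blkmx S (~: S) Sigma.
Definition Sigma10 S := (Sigma01 S)^T.
Definition Sigma11 S := blkmx (~: S) (~: S) Sigma.

Definition beta_hat S y : 'cV[R]_#|S| :=
  invmx (Sigma00 S) *m (n%:R^-1 *: \sum_(i < n) y i *: subv S (x i)).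

Definition mu_hat S (x0 : 'cV[R]_p) y : R := dotv (subv S x0) (beta_hat S y).

Definition beta_wide y : 'cV[R]_p :=
  invmx Sigma *m (n%:R^-1 *: \sum_(i < n) y i *: x i).

Definition mu_wide (x0 : 'cV[R]_p) y : R := dotv x0 (beta_wide y).

Definition omega S (x0 : 'cV[R]_p) : 'cV[R]_#|~: S| :=
  Sigma10 S *m invmx (Sigma00 S) *m subv S x0 - subv (~: S) x0.

Definition Q S : 'M[R]_#|~: S| :=
  invmx (Sigma11 S - Sigma10 S *m invmx (Sigma00 S) *m Sigma01 S).

Definition lambda S (x0 : 'cV[R]_p) beta (sigma : R) : R :=
  dotv (omega S x0) (subv (~: S) beta) / sigma.

Definition kappa S (x0 : 'cV[R]_p) beta (sigma : R) : R :=
  Num.sqrt n%:R * dotv (omega S x0) (subv (~: S) beta)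
  / (Num.sqrt (bilin (omega S x0) (Q S) (omega S x0)) * sigma).

End Regression.

Section Risk.
Context d (T : measurableType d) (R : realType) (P : probability T R).
Variables (n p : nat) (x : 'I_n -> 'cV[R]_p) (beta : 'cV[R]_p).
Variable eps : 'I_n -> {RV P >-> R}.
Implicit Types (S : {set 'I_p}).

Definition response (w : T) (i : 'I_n) : R := dotv (x i) beta + eps i w.

Definition mse (estimator : ('I_n -> R) -> R) (mu : R) : \bar R :=
  'E_P[fun w => (estimator (response w) - mu) ^+ 2].

Definition mse_sub S (x0 : 'cV[R]_p) : \bar R :=
  mse (mu_hat x S x0) (dotv x0 beta).

Definition mse_wide (x0 : 'cV[R]_p) : \bar R :=
  mse (mu_wide x x0) (dotv x0 beta).

(* Here / is the division of \bar R, for which _ / 0 is infinite or 0 and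
   _ / +oo is 0. *)
Definition rr S (x0 : 'cV[R]_p) : \bar R := (mse_sub S x0 / mse_wide x0)%E.

End Risk.

(* Main.v *)
Require Import Defs.
From HB Require Import structures.
From mathcomp Require Import all_boot all_order all_algebra.
From mathcomp Require Import all_classical all_reals all_analysis.
From mathcomp Require Import measurable_realfun ring.
Import Order.TTheory GRing.Theory Num.Theory.
Import numFieldNormedType.Exports.
Local Open Scope classical_set_scope.
Local Open Scope ring_scope.

Set Implicit Arguments.
Unset Strict Implicit.
Unset Printing Implicit Defensive.

(** Both estimators of [mu] have the form [h^T (n^-1 \sum_i y_i x_i)] for a fixed
    vector [h], so with uncorrelated centred errors of variance [sigma^2] their risk
    is [sigma^2 / n * h^T Sigma h + (h^T Sigma beta - mu)^2].  For the submodel the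
    bias is [omega_S^T beta_{S^c}], for the wide model it is 0.  Writing
    [z = Sigma^-1 x0], the [S^c] rows of [Sigma z = x0] give [omega_S = - K z_{S^c}]
    with [K = Q_S^-1] the Schur complement, whence
    [x0^T Sigma^-1 x0 = x_{0,S}^T Sigma_S^-1 x_{0,S} + omega_S^T Q_S omega_S]. *)

(** * Block decomposition of [Sigma] *)

Section BilinearForms.
Variables (R : realType) (k : nat).
Implicit Types (u v w : 'cV[R]_k) (M : 'M[R]_k).

Lemma dotvE u v : dotv u v = \sum_i u i 0 * v i 0.
Proof. by rewrite /dotv mxE; apply: eq_bigr => i _; rewrite mxE. Qed.

Lemma dotvC u v : dotv u v = dotv v u.
Proof. by rewrite !dotvE; apply: eq_bigr => i _; rewrite mulrC. Qed.

Lemma dotvDl u v w : dotv (u + v) w = dotv u w + dotv v w.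
Proof. by rewrite /dotv linearD mulmxDl mxE. Qed.

Lemma dotvNl u v : dotv (- u) v = - dotv u v.
Proof. by rewrite /dotv linearN mulNmx mxE. Qed.

Lemma dotvBl u v w : dotv (u - v) w = dotv u w - dotv v w.
Proof. by rewrite dotvDl dotvNl. Qed.

Lemma dotvZl a u v : dotv (a *: u) v = a * dotv u v.
Proof. by rewrite /dotv linearZ -scalemxAl mxE. Qed.

Lemma dotvDr u v w : dotv w (u + v) = dotv w u + dotv w v.
Proof. by rewrite ![dotv w _]dotvC dotvDl. Qed.

Lemma dotvNr u v : dotv u (- v) = - dotv u v.
Proof. by rewrite dotvC dotvNl dotvC. Qed.

Lemma dotvBr u v w : dotv w (u - v) = dotv w u - dotv w v.
Proof. by rewrite dotvDr dotvNr. Qed.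

Lemma dotvZr a u v : dotv u (a *: v) = a * dotv u v.
Proof. by rewrite dotvC dotvZl dotvC. Qed.

Lemma dotv_sumr (I : finType) u (F : I -> 'cV[R]_k) :
  dotv u (\sum_i F i) = \sum_i dotv u (F i).
Proof. by rewrite /dotv mulmx_sumr summxE. Qed.

End BilinearForms.

Lemma dotv_mulmxl (R : realType) k l (M : 'M[R]_(k, l)) u v :
  dotv (M *m u) v = dotv u (M^T *m v).
Proof. by rewrite /dotv trmx_mul mulmxA. Qed.

Lemma dotv_mulmxr (R : realType) k l (M : 'M[R]_(k, l)) u v :
  dotv u (M *m v) = dotv (M^T *m u) v.
Proof. by rewrite dotv_mulmxl trmxK. Qed.

(** [kermx] is a left kernel, so the proof passes to [M^T]: the transposed rows of [kermx M^T] are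
    vectors killed by [M]. *)
Lemma unitmx_ker0 (F : fieldType) k (M : 'M[F]_k) :
  (forall v : 'cV[F]_k, M *m v = 0 -> v = 0) -> M \in unitmx.
Proof.
move=> M0; rewrite -unitmx_tr -row_free_unit -kermx_eq0.
apply/eqP/row_matrixP => i; rewrite row0; apply: trmx_inj; rewrite trmx0.
apply: M0; apply: trmx_inj; rewrite trmx_mul trmxK trmx0.
by rewrite -row_mul mulmx_ker row0.
Qed.

(** * Coordinate selection matrices *)

Section Selection.
Variables (R : realType) (p : nat).
Implicit Types S U : {set 'I_p}.

(** The columns are the basis vectors indexed by [S]. Subvectors and blocks thereby become matrix
    products, and block identities follow from associativity. *)
Definition sel S : 'M[R]_(p, #|S|) := colsub (@enum_val _ (mem S)) 1%:M.

Lemma subvE S (u : 'cV[R]_p) : subv S u = (sel S)^T *m u.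
Proof.
by rewrite /sel trmx_mxsub trmx1 mul_rowsub_mx mul1mx.
Qed.

Lemma blkmxE S U (M : 'M[R]_p) : blkmx S U M = (sel S)^T *m M *m sel U.
Proof.
by rewrite /sel trmx_mxsub trmx1 mul_rowsub_mx mul1mx mulmx_colsub mulmx1 -mxsub_comp.
Qed.

Lemma sel_tr_mul S U : (sel S)^T *m sel U =
  \matrix_(i, j) (@enum_val _ (mem S) i == @enum_val _ (mem U) j)%:R.
Proof.
rewrite -[_^T]mulmx1 -blkmxE.
by apply/matrixP => i j; rewrite !mxE.
Qed.

Lemma sel_tr_mul_id S : (sel S)^T *m sel S = 1%:M.
Proof.
by rewrite sel_tr_mul; apply/matrixP => i j; rewrite !mxE (inj_eq enum_val_inj).
Qed.

Lemma sel_tr_mulC S : (sel (~: S))^T *m sel S = 0.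
Proof.
rewrite sel_tr_mul; apply/matrixP => i j; rewrite !mxE.
case: eqP => // E; have := enum_valP i; rewrite E inE.
by rewrite (enum_valP j).
Qed.

Lemma sel_mul_tr S i j : (sel S *m (sel S)^T) i j = ((i == j) && (i \in S))%:R.
Proof.
rewrite mxE.
under eq_bigr => l _ do rewrite !mxE.
(* The sum over ['I_#|S|] becomes a sum over the elements of [S], where at most the index [i]
   contributes. *)
rewrite -(big_enum_val (fun l => (i == l)%:R * (j == l)%:R))/=.
case: (boolP (i \in S)) => iS; rewrite ?andbT ?andbF; last first.
  by rewrite big1// => l lS; rewrite eq_sym (negbTE (memPn iS l lS)) mul0r.
rewrite (bigD1 i)//= eqxx mul1r eq_sym big1 ?addr0// => l /andP[_ li].
by rewrite eq_sym (negbTE li) mul0r.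
Qed.

Lemma sel_decomp S :
  sel S *m (sel S)^T + sel (~: S) *m (sel (~: S))^T = 1%:M.
Proof.
apply/matrixP => i j; rewrite mxE !sel_mul_tr [in RHS]mxE inE.
by case: (i == j); case: (i \in S); rewrite ?addr0 ?add0r.
Qed.

Lemma sel_subv S (u : 'cV[R]_p) :
  u = sel S *m subv S u + sel (~: S) *m subv (~: S) u.
Proof. by rewrite !subvE !mulmxA -mulmxDl sel_decomp mul1mx. Qed.

Lemma subv_mul_sel S U (M : 'M[R]_p) v :
  subv S (M *m (sel U *m v)) = blkmx S U M *m v.
Proof. by rewrite subvE blkmxE !mulmxA. Qed.

Lemma subvB S (u v : 'cV[R]_p) : subv S (u - v) = subv S u - subv S v.
Proof. by rewrite !subvE mulmxBr. Qed.

Lemma subvD S (u v : 'cV[R]_p) : subv S (u + v) = subv S u + subv S v.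
Proof. by rewrite !subvE mulmxDr. Qed.

End Selection.
Arguments sel {R p} S.

(** * Positive definiteness of [Sigma] and its Schur complement *)

Section Schur.
Variables (R : realType) (n p : nat) (x : 'I_n -> 'cV[R]_p).
Hypothesis Sigma_unit : Sigma x \in unitmx.
Variable S : {set 'I_p}.

Let B := Sigma00 x S.
Let C := Sigma01 x S.
Let D := Sigma11 x S.
Let K := D - Sigma10 x S *m invmx B *m C.

Lemma tr_Sigma : (Sigma x)^T = Sigma x.
Proof.
rewrite /Sigma linearZ/= linear_sum/=; congr (_ *: _).
by apply: eq_bigr => i _; rewrite trmx_mul trmxK.
Qed.

(** The Gram form of [Sigma] gives positivity here, and later both the mean and the variance of a
    linear estimator. *)
Lemma bilin_Sigma u v :
  bilin u (Sigma x) v = n%:R^-1 * \sum_i dotv (x i) u * dotv (x i) v.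
Proof.
rewrite /bilin /Sigma -scalemxAl dotvZr mulmx_suml dotv_sumr; congr (_ * _).
apply: eq_bigr => i _; rewrite -mulmxA dotv_mulmxr dotvE big_ord1.
by congr (_ * _).
Qed.

Lemma bilin_Sigma_ge0 u : 0 <= bilin u (Sigma x) u.
Proof.
rewrite bilin_Sigma mulr_ge0 ?invr_ge0// sumr_ge0// => i _.
by rewrite -expr2 sqr_ge0.
Qed.

(** A vanishing sum of squares forces every [x_i^T u] to be 0, so [Sigma u = 0], and invertibility
    gives [u = 0]. *)
Lemma bilin_Sigma_eq0 u : bilin u (Sigma x) u = 0 -> u = 0.
Proof.
rewrite bilin_Sigma => /eqP; rewrite mulf_eq0 => /orP[|].
  (* If [n%:R = 0], its inverse is 0 by convention; then [Sigma = 0], and invertibility still gives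
     [u = 0]. *)
  rewrite invr_eq0 => /eqP n0.
  have : Sigma x *m u = 0 by rewrite /Sigma n0 invr0 scale0r mul0mx.
  by move/(congr1 (mulmx (invmx (Sigma x)))); rewrite mulKmx// mulmx0.
rewrite psumr_eq0; last by move=> i _; rewrite -expr2 sqr_ge0.
move=> /allP xu0.
have : Sigma x *m u = 0.
  rewrite /Sigma -scalemxAl mulmx_suml big1 ?scaler0// => i _.
  rewrite -mulmxA (_ : (x i)^T *m u = 0) ?mulmx0//.
  apply/matrixP => a b; rewrite !ord1 [RHS]mxE.
  have := xu0 i (mem_index_enum _).
  by rewrite /= mulf_eq0 orbb => /eqP.
by move/(congr1 (mulmx (invmx (Sigma x)))); rewrite mulKmx// mulmx0.
Qed.

Lemma bilin_Sigma_gt0 u : u != 0 -> 0 < bilin u (Sigma x) u.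
Proof.
move=> u0; rewrite lt0r bilin_Sigma_ge0 andbT.
by apply: contra_neq u0; exact: bilin_Sigma_eq0.
Qed.

(** The quadratic form of the block at [v] is that of [Sigma] at the zero-padded vector
    [sel S *m v], so definiteness is inherited. *)
Lemma Sigma00_unit : Sigma00 x S \in unitmx.
Proof.
apply: unitmx_ker0 => v Bv0.
have : bilin (sel S *m v) (Sigma x) (sel S *m v) = 0.
  rewrite /bilin dotv_mulmxl !mulmxA -blkmxE -/(Sigma00 x S) Bv0.
  by rewrite dotvE big1// => i _; rewrite mxE mulr0.
move/bilin_Sigma_eq0/(congr1 (mulmx (sel S)^T)).
by rewrite mulmxA sel_tr_mul_id mul1mx mulmx0.
Qed.

Lemma tr_Sigma00 : (Sigma00 x S)^T = Sigma00 x S.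
Proof. by rewrite /Sigma00 blkmxE !trmx_mul trmxK tr_Sigma mulmxA. Qed.

Lemma Sigma10E : Sigma10 x S = blkmx (~: S) S (Sigma x).
Proof. by rewrite /Sigma10 /Sigma01 !blkmxE !trmx_mul trmxK tr_Sigma mulmxA. Qed.

(* The vector with [S^c]-part [b] that is [Sigma]-orthogonal to everything
   supported on [S]; on such vectors [Sigma] acts as the Schur complement [K]. *)
Definition schur_lift (b : 'cV[R]_#|~: S|) : 'cV[R]_p :=
  sel (~: S) *m b - sel S *m (invmx B *m (C *m b)).

(** In the [S] rows [C b] cancels against [B B^-1 C b]; in the [S^c] rows [D b - Sigma10 B^-1 C b]
    remains. *)
Lemma Sigma_schur_lift b : Sigma x *m schur_lift b = sel (~: S) *m (K *m b).
Proof.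
rewrite [LHS](sel_subv S) /schur_lift mulmxBr !subvB !subv_mul_sel.
rewrite -/(Sigma00 x S) mulKVmx ?Sigma00_unit// subrr mulmx0 add0r.
by rewrite /K mulmxBl -!mulmxA Sigma10E.
Qed.

Lemma schur_liftK b : (sel (~: S))^T *m schur_lift b = b.
Proof.
by rewrite /schur_lift mulmxBr !mulmxA sel_tr_mul_id sel_tr_mulC !mul0mx mul1mx subr0.
Qed.

(** The lift is injective and carries the kernel of [K] into the kernel of [Sigma], which is
    trivial. *)
Lemma Schur_unit : K \in unitmx.
Proof.
apply: unitmx_ker0 => b Kb0.
have := Sigma_schur_lift b; rewrite Kb0 mulmx0.
move/(congr1 (mulmx (invmx (Sigma x)))); rewrite mulKmx// mulmx0 => w0.
by rewrite -(schur_liftK b) w0 mulmx0.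
Qed.

Lemma bilin_Schur b : bilin b K b = bilin (schur_lift b) (Sigma x) (schur_lift b).
Proof. by rewrite {2}/bilin Sigma_schur_lift dotv_mulmxr schur_liftK. Qed.

Variable x0 : 'cV[R]_p.

Let om := omega x S x0.
Let z := invmx (Sigma x) *m x0.

(** After [x0 = Sigma z] is split into blocks, [Sigma10 z_S] occurs in both terms of [omega] and
    cancels. *)
Lemma omega_Schur : om = - (K *m subv (~: S) z).
Proof.
have subv_x0 U : subv U x0 = blkmx U S (Sigma x) *m subv S z +
    blkmx U (~: S) (Sigma x) *m subv (~: S) z.
  by rewrite -[x0](mulKVmx Sigma_unit) -/z {1}[z](sel_subv S) mulmxDr subvD !subv_mul_sel.
have x0S : subv S x0 = B *m subv S z + C *m subv (~: S) z := subv_x0 S.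
have x0C : subv (~: S) x0 = Sigma10 x S *m subv S z + D *m subv (~: S) z.
  by rewrite subv_x0 Sigma10E.
rewrite /om /omega x0S x0C mulmxDr -!mulmxA mulKmx ?Sigma00_unit//.
rewrite /K mulmxBl !mulmxA opprB opprD addrACA subrr add0r.
by [].
Qed.

Lemma mul_Q_omega : Q x S *m om = - subv (~: S) z.
Proof. by rewrite omega_Schur mulmxN /Q mulKmx ?Schur_unit. Qed.

(** Replaces the inverse [Q] by [K] itself, whose sign is known from [bilin_Schur]. *)
Lemma bilin_Q_omega_lift :
  bilin om (Q x S) om = bilin (subv (~: S) z) K (subv (~: S) z).
Proof.
by rewrite /bilin mul_Q_omega omega_Schur dotvNl dotvNr opprK dotvC.
Qed.

Lemma bilin_Q_omega_ge0 : 0 <= bilin om (Q x S) om.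
Proof. by rewrite bilin_Q_omega_lift bilin_Schur bilin_Sigma_ge0. Qed.

Lemma bilin_Q_omega_gt0 : om != 0 -> 0 < bilin om (Q x S) om.
Proof.
move=> om0; rewrite bilin_Q_omega_lift bilin_Schur bilin_Sigma_gt0//.
apply: contra_neq om0 => /(congr1 (mulmx (sel (~: S))^T)).
by rewrite schur_liftK mulmx0 omega_Schur => ->; rewrite mulmx0 oppr0.
Qed.

Lemma bilin_wide : bilin x0 (invmx (Sigma x)) x0 =
  bilin (subv S x0) (invmx (Sigma00 x S)) (subv S x0) + bilin om (Q x S) om.
Proof.
(* The [S] rows of [Sigma z = x0] are solved for [z_S]. In [x0^T z] the terms containing [z_{S^c}]
   then collect to [- omega^T z_{S^c}], which is [omega^T Q omega]. *)
have aE : subv S z = invmx B *m (subv S x0 - C *m subv (~: S) z).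
  have -> : subv S x0 = B *m subv S z + C *m subv (~: S) z.
    rewrite -[x0](mulKVmx Sigma_unit) -/z {1}[z](sel_subv S).
    by rewrite mulmxDr subvD !subv_mul_sel.
  by rewrite addrK mulKmx ?Sigma00_unit.
rewrite {1}/bilin -/z [z](sel_subv S) dotvDr !dotv_mulmxr -!subvE aE.
rewrite mulmxBr dotvBr -/(bilin _ _ _) -addrA; congr (_ + _).
rewrite /bilin mul_Q_omega dotvNr /om /omega dotvBl opprB addrC dotv_mulmxl.
by rewrite trmx_mul trmx_inv tr_Sigma00 /Sigma10 trmxK mulmxA.
Qed.

Lemma bilin_wide_gt0 : x0 != 0 -> 0 < bilin x0 (invmx (Sigma x)) x0.
Proof.
move=> x00; have -> : bilin x0 (invmx (Sigma x)) x0 = bilin z (Sigma x) z.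
  by rewrite /bilin /z mulKVmx// dotvC.
apply: bilin_Sigma_gt0; apply: contra_neq x00 => z0.
by rewrite -(mulKVmx Sigma_unit x0) -/z z0 mulmx0.
Qed.

End Schur.

(** * Moments *)

Section SecondMoments.
Context d (T : measurableType d) (R : realType) (P : probability T R).

Lemma sqr_integrable_Lfun2 d' (T' : measurableType d') (m : measure T' R) (f : T' -> R) :
  measurable_fun [set: T'] f -> (\int[m]_x (f x ^+ 2)%:E < +oo)%E -> f \in Lfun m 2%:E.
Proof.
move=> mf fley; rewrite inE; apply/andP; split; rewrite inE//=.
rewrite /finite_norm unlock poweR_lty//.
by under eq_integral => t _ do
  rewrite /comp abse_EFin poweR_EFin powR_mulrn// real_normK ?num_real//.
Qed.

(** Independence identifies the law of [(X, Y)] with the product of the marginal laws, and Fubini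
    then factors the integral of the product of coordinates. *)
Lemma expectation_mul_indep (X Y : {RV P >-> R}) :
  (X : T -> R) \in Lfun P 2%:E -> (Y : T -> R) \in Lfun P 2%:E ->
  (forall A B : set R, measurable A -> measurable B ->
    P (X @^-1` A `&` Y @^-1` B) = (P (X @^-1` A) * P (Y @^-1` B))%E) ->
  ('E_P[fun w => (X w * Y w)%R] = 'E_P[X] * 'E_P[Y])%E.
Proof.
move=> X2 Y2 indep.
pose Z w : R * R := (X w, Y w).
have mZ : measurable_fun [set: T] Z by apply: measurable_fun_pair.
pose f (z : R * R) : \bar R := (z.1 * z.2)%:E.
have mf : measurable_fun [set: R * R] f by apply/measurable_EFinP; exact: measurable_funM.
have ifZ : P.-integrable [set: T] (f \o Z).
  by apply/Lfun1_integrable; exact: Lfun2_mul_Lfun1.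
pose m1 := distribution P X; pose m2 := distribution P Y.
have prodE : forall A, measurable A -> (m1 \x m2)%E A = pushforward P Z A.
  move=> A mA; apply: (@product_measure_unique _ _ _ _ _ m1 m2 (pushforward P Z)) => //.
(* Fubini needs integrability under the product law; it is carried over from [X Y], which is
   integrable as a product of two square-integrable variables. *)
have ipf : (m1 \x m2)%E.-integrable [set: R * R] f.
  apply/integrableP; split => //.
  rewrite (eq_measure_integral (pushforward P Z)); last by move=> A mA _; exact: prodE.
  rewrite ge0_integral_pushforward//; last exact: measurableT_comp.
  by case/integrableP : ifZ.
rewrite unlock.
transitivity (\int[pushforward P Z]_z f z)%E.
  by rewrite (integral_pushforward mZ mf).
rewrite (eq_measure_integral (m1 \x m2)%E); last by move=> A mA _; exact/esym/prodE.
rewrite -integral12_prod_meas1//.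
have finP : P [set: T] \is a fin_num by rewrite probability_setT.
have X1 : P.-integrable [set: T] (EFin \o X).
  by apply/Lfun1_integrable; exact: (Lfun_subset12 finP).
have Y1 : P.-integrable [set: T] (EFin \o Y).
  by apply/Lfun1_integrable; exact: (Lfun_subset12 finP).
have mE : measurable_fun [set: R] (@EFin R) by exact/measurable_EFinP.
have iY : m2.-integrable [set: R] (@EFin R) by apply: integrable_pushforward.
have iX : m1.-integrable [set: R] (@EFin R) by apply: integrable_pushforward.
rewrite -[X in (X * _)%E](integral_distribution mE X1).
rewrite -[X in (_ * X)%E](integral_distribution mE Y1).
rewrite -/m1 -/m2.
transitivity (\int[m1]_x (x%:E * \int[m2]_y y%:E))%E.
  apply: eq_integral => a _; rewrite /fubini_F /f/=.
  under eq_integral do rewrite EFinM.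
  by rewrite integralZl.
have fY : (\int[m2]_y y%:E)%E \is a fin_num by apply: integrable_fin_num.
by rewrite -(fineK fY) integralZr.
Qed.

(** Integrability is bundled with the value, so that linearity of expectation composes without side
    conditions. *)
Definition has_mean (f : T -> R) (r : R) : Prop :=
  f \in Lfun P 1 /\ ('E_P[f] = r%:E)%E.

Lemma has_mean_cst r : has_mean (fun=> r) r.
Proof. by split; [exact: Lfun_cst|exact: expectation_cst]. Qed.

Lemma has_meanD f g a b : has_mean f a -> has_mean g b ->
  has_mean (fun w => f w + g w) (a + b).
Proof.
move=> [lf Ef] [lg Eg]; split.
  by apply: (rpredD (S := Lfun P 1)).
by rewrite (expectationD lf lg) Ef Eg.
Qed.

Lemma has_meanZ k f a : has_mean f a -> has_mean (fun w => k * f w) (k * a).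
Proof.
move=> [lf Ef].
have -> : (fun w => k * f w) = k \o* f by apply/funext => w /=; rewrite mulrC.
by split; [exact: Lfun_scale|rewrite expectationZl// Ef].
Qed.

Lemma has_mean_sum (I : Type) (s : seq I) f a : (forall i, has_mean (f i) (a i)) ->
  has_mean (fun w => \sum_(i <- s) f i w) (\sum_(i <- s) a i).
Proof.
move=> fa; elim: s => [|i s IH].
  rewrite big_nil; under eq_fun do rewrite big_nil.
  exact: has_mean_cst.
by rewrite big_cons; under eq_fun do rewrite big_cons; exact: has_meanD.
Qed.

(** Only centring, a common variance [v] and zero correlation matter: the cross terms of the
    expanded square have mean 0. *)
Lemma second_moment_affine n (X : 'I_n -> T -> R) (c : 'I_n -> R) (b v : R) :
  (forall i, has_mean (X i) 0) ->
  (forall i j, has_mean (fun w => X i w * X j w) (v * (i == j)%:R)) ->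
  ('E_P[fun w => ((b + \sum_i c i * X i w) ^+ 2)%R] =
  (b ^+ 2 + v * \sum_i c i ^+ 2)%:E)%E.
Proof.
move=> X0 XX.
have sqE w : (b + \sum_i c i * X i w) ^+ 2 = b ^+ 2 +
    ((b *+ 2) * (\sum_i c i * X i w) + \sum_i \sum_j c i * c j * (X i w * X j w)).
  rewrite sqrrD -addrA; congr (_ + _); rewrite mulrnAl; congr (_ + _).
  rewrite expr2 big_distrlr/=; apply: eq_bigr => i _; apply: eq_bigr => j _.
  by rewrite mulrACA.
under eq_fun do rewrite sqE.
(* The term mirrors the shape of [sqE], so it yields the mean of the whole expansion at once. *)
have := has_meanD (has_mean_cst (b ^+ 2)) (has_meanD
  (has_meanZ (b *+ 2) (has_mean_sum (index_enum 'I_n) (fun i => has_meanZ (c i) (X0 i))))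
  (has_mean_sum (index_enum 'I_n) (fun i =>
    (has_mean_sum (index_enum 'I_n) (fun j => has_meanZ (c i * c j) (XX i j)))))).
move=> [_ ->]; congr (_ + _)%:E.
rewrite big1 ?mulr0 ?add0r//; last by move=> i _; rewrite mulr0.
rewrite mulr_sumr; apply: eq_bigr => i _.
rewrite (bigD1 i)//= eqxx big1 ?addr0; last first.
  by move=> j ji; rewrite eq_sym (negbTE ji) !mulr0.
by rewrite mulr1 mulrC expr2.
Qed.

End SecondMoments.

(** * First two moments of the centred normal law *)

Section NormalMoments.
Variables (R : realType) (s : R).
Hypothesis s_gt0 : 0 < s.
Local Notation mu := (@lebesgue_measure R).
Local Notation pdf := (normal_pdf 0 s).

Let s_neq0 : s != 0. Proof. by rewrite gt_eqF. Qed.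

(** Change of variables uses the abstract Radon-Nikodym derivative. It agrees almost everywhere with
    [normal_pdf], since both have the same integral over every measurable set. *)
Lemma ge0_integral_normal_prob (m : R) (f : R -> R) :
  measurable_fun [set: R] f -> (forall x, 0 <= f x) ->
  (\int[normal_prob m s]_x (f x)%:E = \int[mu]_x (f x * normal_pdf m s x)%:E)%E.
Proof.
move=> mf f0.
have dom := normal_prob_dominates m s.
have f0' x : (0 <= (f x)%:E)%E by rewrite lee_fin.
have mf' : measurable_fun [set: R] (EFin \o f) by exact/measurable_EFinP.
under [RHS]eq_integral do rewrite EFinM.
rewrite -(Radon_Nikodym_SigmaFinite.change_of_variables dom f0')//=.
apply: ae_eq_integral => //.
- apply: emeasurable_funM => //; apply: (measurable_int mu).
  exact: Radon_Nikodym_SigmaFinite.f_integrable.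
- by apply: emeasurable_funM => //; apply/measurable_EFinP; exact: measurable_normal_pdf.
- apply: ae_eqe_mul2l => /=.
  apply: integral_ae_eq => //=.
  + exact: Radon_Nikodym_SigmaFinite.f_integrable.
  + by apply/measurable_EFinP; exact: measurable_normal_pdf.
  + by move=> E _ mE; rewrite -Radon_Nikodym_SigmaFinite.f_integral.
Qed.

Lemma normal_pdfN x : pdf (- x) = pdf x.
Proof. by rewrite /normal_pdf (negbTE s_neq0) /normal_fun !subr0 sqrrN. Qed.

(** This differential equation makes [- s^2 pdf] an antiderivative of [x pdf(x)]. *)
Lemma is_derive_normal_pdf (x : R) :
  is_derive x (1 : R) (pdf : R -> R) (- (x / s ^+ 2) * pdf x).
Proof.
rewrite /normal_pdf (negbTE s_neq0) /normal_fun.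
set c := normal_peak s.
have -> : (fun t : R => c * expR (- (t - 0) ^+ 2 / (s ^+ 2 *+ 2))) =
   (fun t => c * expR (- (s ^+ 2 *+ 2)^-1 * (t * t))).
  by apply/funext => t; rewrite subr0; congr (c * expR _); ring.
apply: is_derive_eq.
rewrite !scaler1 /GRing.scale/=.
have -> : - (x - 0) ^+ 2 / (s ^+ 2 *+ 2) = - (s ^+ 2 *+ 2)^-1 * (x * x).
  by rewrite subr0; ring.
by field; rewrite s_neq0.
Qed.

(** Disposes of the boundary term in the integration by parts for the second moment. *)
Lemma cvg_mul_normal_pdf : n.+1%:R * pdf n.+1%:R @[n --> \oo] --> (0 : R).
Proof.
(* From [exp(-y) <= 1/y] at [y = x^2 / (2 s^2)] one gets [x pdf(x) <= c / x], and [harmonic n] is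
   [1 / (n+1)]. *)
pose c := normal_peak s * (s ^+ 2 *+ 2).
have cvgc : c * harmonic n @[n --> \oo] --> (0 : R).
  by rewrite -[X in _ --> X](mulr0 c); apply: cvgMr; exact: cvg_harmonic.
apply: (squeeze_cvgr _ _ cvgc); [near=> n|exact: cvg_cst].
rewrite mulr_ge0 ?normal_pdf_ge0//=.
rewrite /normal_pdf (negbTE s_neq0) /normal_fun subr0 /harmonic/= /c.
set x : R := n.+1%:R; have x0 : 0 < x by rewrite ltr0n.
have e0 : 0 < s ^+ 2 *+ 2 by rewrite pmulrn_lgt0// exprn_gt0.
set e := s ^+ 2 *+ 2 in e0 *.
rewrite mulrCA -mulrA ler_wpM2l ?normal_peak_ge0//.
rewrite mulNr expRN ler_pdivrMr ?expR_gt0//.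
have h : x ^+ 2 / e <= expR (x ^+ 2 / e).
  by apply: le_trans (expR_ge1Dx _); rewrite lerDr.
apply: le_trans (ler_wpM2l _ h); last by rewrite divr_ge0// ltW.
suff -> : e / x * (x ^+ 2 / e) = x by [].
by clearbody x e; field; rewrite !gt_eqF.
Unshelve. all: by end_near. Qed.

Lemma continuous_normal_pdf0 : continuous pdf.
Proof. exact: continuous_normal_pdf. Qed.

(** Integration by parts on the factors [x] and [x pdf(x)], the latter with antiderivative
    [- s^2 pdf]. *)
Lemma integral0a_sqr_normal_pdf (a : R) : 0 < a ->
  (\int[mu]_(x in `[0%R, a]) (x ^+ 2 * pdf x)%:E =
   (s ^+ 2)%:E * (\int[mu]_(x in `[0%R, a]) (pdf x)%:E) -
   (s ^+ 2 * (a * pdf a))%:E)%E.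
Proof.
move=> a0.
have dG (x : R) : is_derive x (1:R) (fun t : R => - (s ^+ 2 * pdf t)) (x * pdf x).
  have ? := is_derive_normal_pdf x.
  apply: is_derive_eq; rewrite /GRing.scale/=.
  by field; rewrite s_neq0.
have cG : continuous (fun t : R => - (s ^+ 2 * pdf t)).
  by move=> t; apply: cvgN; apply: cvgMr; exact: continuous_normal_pdf0.
have intpdf : mu.-integrable `[0, a] (EFin \o pdf).
  by apply: (integrableS _ _ (@subsetT _ _)) => //; exact: integrable_normal_pdf.
under eq_integral do rewrite expr2 -mulrA.
rewrite (@integration_by_parts R id (fun t => - (s ^+ 2 * pdf t)) (cst 1)
  (fun t => t * pdf t))//.
- rewrite mul0r subr0 addeC mulrN EFinN mulrCA; congr (_ - _)%E.
  under eq_integral do rewrite mul1r -mulNr EFinM.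
  by rewrite integralZl// EFinN mulNe oppeK.
- by apply: continuous_subspaceT => t; exact: cvg_cst.
- split; [by []|exact: cvg_at_right_filter|exact: cvg_at_left_filter].
- by move=> x _; rewrite derive1E derive_id.
- by apply: continuous_subspaceT => t; apply: cvgM => //; exact: continuous_normal_pdf0.
- split; [by []|apply: cvg_at_right_filter; exact: cG|apply: cvg_at_left_filter; exact: cG].
- by move=> x _; rewrite derive1E derive_val.
Qed.

(** By evenness it suffices to work on the half-line. There the second moment is the limit over
    [[0, n+1]], where integration by parts leaves [s^2] times the mass. *)
Lemma integralT_sqr_normal_pdf :
  (\int[mu]_x (x ^+ 2 * pdf x)%:E = (s ^+ 2)%:E)%E.
Proof.
have foldE (f : R -> R) : (forall x, 0 <= f x) -> continuous f ->
    (forall x, f (- x) = f x) ->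
  (\int[mu]_x (f x)%:E = 2%:E * \int[mu]_(x in `[0%R, +oo[) (f x)%:E)%E.
  move=> f0 cf fN; rewrite ge0_symfun_integralT// ?set_itvcy//.
  by move=> t /=; rewrite fN.
have pdf0 x : 0 <= x ^+ 2 * pdf x by rewrite mulr_ge0 ?sqr_ge0 ?normal_pdf_ge0.
have cpdf : continuous (fun x : R => x ^+ 2 * pdf x).
  by move=> x; apply: cvgM; [exact: sqr_continuous|exact: continuous_normal_pdf0].
rewrite foldE//; last by move=> x; rewrite sqrrN normal_pdfN.
(* The total mass 1 is inserted on the right and folded too, so that the factor 2 cancels. *)
rewrite -[RHS]mule1 -(integral_normal_pdf 0 s) foldE; last 3 first.
- exact: normal_pdf_ge0.
- exact: continuous_normal_pdf0.
- exact: normal_pdfN.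
rewrite muleCA; congr (_ * _)%E.
(* The shift to [n.+1] keeps the upper limit positive, as the truncated identity requires. *)
have cvgS (u : (\bar R)^nat) (l : \bar R) :
    u @ \oo --> l -> u n.+1 @[n --> \oo] --> l.
  by rewrite cvg_shiftS.
have c2 := cvgS _ _ (@ge0_cvgn_integral R mu _ pdf0 (continuous_measurable_fun cpdf)).
have c0 := cvgS _ _ (@ge0_cvgn_integral R mu _
  (normal_pdf_ge0 0 s) (measurable_normal_pdf 0 s)).
have c1 : (s ^+ 2 * (n.+1%:R * pdf n.+1%:R))%:E @[n --> \oo] --> (0%R : R)%:E.
  apply: cvg_EFin; first by near=> n.
  rewrite -[X in _ --> X](mulr0 (s ^+ 2)).
  by apply: cvgMr; exact: cvg_mul_normal_pdf.
have fs2 : (s ^+ 2)%:E \is a fin_num by [].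
have f0 : (- (0%R : R)%:E)%E \is a fin_num by [].
have c3 := cvgeB (fin_num_adde_defl _ f0) (cvgeZl fs2 c0) c1.
move: c2; under eq_fun do rewrite integral0a_sqr_normal_pdf ?ltr0n//.
move=> c2; have := cvg_unique _ c2 (c3 _).
by rewrite sube0; exact.
Unshelve. all: by end_near. Qed.

(** Splitting at 0 and substituting on the negative half-line shows that a reflection merely swaps
    the two halves. *)
Lemma ge0_integralT_opp (G : R -> R) : continuous G -> (forall x, 0 <= G x) ->
  (\int[mu]_x (G (- x))%:E = \int[mu]_x (G x)%:E)%E.
Proof.
have split0 (H : R -> R) : continuous H -> (forall x, 0 <= H x) ->
    (\int[mu]_x (H x)%:E =
     \int[mu]_(x in `[0%R, +oo[) (H (- x)%R)%:E + \int[mu]_(x in `[0%R, +oo[) (H x)%:E)%E.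
  move=> cH H0; have mH : measurable_fun [set: R] H by exact: continuous_measurable_fun.
  rewrite -(setUv `]-oo, 0%R]%classic) ge0_integral_setU//=; last 4 first.
  - exact: measurableC.
  - by apply/measurable_EFinP; rewrite setUv.
  - by move=> x _; rewrite lee_fin.
  - exact/disj_setPCl.
  rewrite setCitvl; congr +%E.
    rewrite -{1}oppr0 ge0_integration_by_substitutionNy//.
    exact: continuous_subspaceT.
  rewrite integral_itv_obnd_cbnd//.
  exact/measurable_EFinP/measurable_funTS.
move=> cG G0; rewrite [RHS]split0// [LHS](split0 (G \o -%R))//.
- by rewrite addeC; congr +%E; apply: eq_integral => x _ /=; rewrite opprK.
- by move=> x; apply: continuous_comp; [exact: opp_continuous|exact: cG].
- by move=> x /=.
Qed.

Lemma integral_normal_prob_sqr :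
  (\int[normal_prob 0 s]_x (x ^+ 2)%:E = (s ^+ 2)%:E)%E.
Proof.
rewrite ge0_integral_normal_prob.
- exact: integralT_sqr_normal_pdf.
- exact: measurable_funX.
- by move=> x; exact: sqr_ge0.
Qed.

Lemma Lfun2_normal_prob : (@idfun R) \in Lfun (normal_prob 0 s) 2%:E.
Proof.
apply: sqr_integrable_Lfun2.
  exact: (@measurable_id _ R).
by have := ltry (s ^+ 2); rewrite -integral_normal_prob_sqr.
Qed.

(** The density is even, so the positive and negative parts of the identity have equal integrals;
    the finite second moment makes these finite and their difference 0. *)
Lemma integral_normal_prob_id : (\int[normal_prob 0 s]_x x%:E = 0)%E.
Proof.
have finP : normal_prob 0 s [set: R] \is a fin_num by rewrite probability_setT.
have int1 : (normal_prob 0 s).-integrable [set: R] (@EFin R).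
  by have /Lfun1_integrable := Lfun_subset12 finP Lfun2_normal_prob.
have posE x : ((@EFin R)^\+ x)%E = (Num.max x 0)%:E by rewrite funeposE -EFin_max.
have negE x : ((@EFin R)^\- x)%E = (Num.max (- x) 0)%:E by rewrite funenegE -EFin_max.
have cmax : continuous (fun x : R => Num.max x 0).
  by move=> x; apply: continuous_max => //; exact: cst_continuous.
have mmax : measurable_fun [set: R] (fun x : R => Num.max x 0).
  by exact: continuous_measurable_fun.
rewrite integralE.
suff -> : (\int[normal_prob 0 s]_x ((@EFin R)^\- x) =
           \int[normal_prob 0 s]_x ((@EFin R)^\+ x))%E.
  rewrite subee// integrable_fin_num//.
  exact: integrable_funepos.
under eq_integral do rewrite negE.
under [RHS]eq_integral do rewrite posE.
rewrite !ge0_integral_normal_prob//; first last.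
- by move=> x; rewrite le_max lexx orbT.
- exact: (measurableT_comp mmax).
- by move=> x; rewrite le_max lexx orbT.
under eq_integral => x _ do rewrite -[normal_pdf 0 s x]normal_pdfN.
rewrite (ge0_integralT_opp (G := fun x => Num.max x 0 * pdf x))//.
- by move=> x; apply: cvgM; [exact: cmax|exact: continuous_normal_pdf0].
- by move=> x; rewrite mulr_ge0 ?normal_pdf_ge0// le_max lexx orbT.
Qed.

End NormalMoments.

(** * Risks *)

Section NormalErrors.
Context d (T : measurableType d) (R : realType) (P : probability T R).
Variables (n : nat) (s : R) (eps : 'I_n -> {RV P >-> R}).
Hypothesis s_gt0 : 0 < s.
Hypothesis eps_normal : iid_normal 0 s eps.

(* [distribution] lives on [R], but [normal_prob] on its copy [measurableTypeR R],
   which has the same measurable sets under another display. *)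
Let measurable_eps i : measurable_fun [set: T] (eps i : T -> measurableTypeR R).
Proof.
have meps : measurable_fun [set: T] (eps i) by exact: measurable_funP.
by move=> _ Y mY; exact: meps.
Qed.

Lemma ge0_integral_eps i (f : R -> R) :
  measurable_fun [set: R] f -> (forall x, 0 <= f x) ->
  (\int[P]_w (f (eps i w))%:E = \int[normal_prob 0 s]_x (f x)%:E)%E.
Proof.
move=> mf f0.
rewrite -(eq_measure_integral (normal_prob 0 s)
  (m1 := pushforward P (eps i : T -> measurableTypeR R))); last first.
  by move=> A mA _; exact: eps_normal.2.
rewrite ge0_integral_pushforward//.
  exact/measurable_EFinP.
by move=> x _; rewrite lee_fin.
Qed.

Lemma eps_sqr i : (\int[P]_w (eps i w ^+ 2)%:E = (s ^+ 2)%:E)%E.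
Proof.
rewrite -(integral_normal_prob_sqr s_gt0).
apply: (ge0_integral_eps i (f := fun x => x ^+ 2)); first exact: measurable_funX.
by move=> x; exact: sqr_ge0.
Qed.

Lemma eps_Lfun2 i : (eps i : T -> R) \in Lfun P 2%:E.
Proof. by apply: sqr_integrable_Lfun2 => //; rewrite eps_sqr ltry. Qed.

Lemma eps_mean i : has_mean P (eps i) 0.
Proof.
have finP : P [set: T] \is a fin_num by rewrite probability_setT.
have eps1 := Lfun_subset12 finP (eps_Lfun2 i); split=> //.
have /Lfun1_integrable ieps := eps1.
have mE : measurable_fun [set: measurableTypeR R] (@EFin R) by exact/measurable_EFinP.
rewrite unlock.
transitivity (\int[pushforward P (eps i : T -> measurableTypeR R)]_x x%:E)%E.
  by rewrite (integral_pushforward (measurable_eps i) mE).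
rewrite (eq_measure_integral (normal_prob 0 s)).
  exact: integral_normal_prob_id.
by move=> A mA _; exact: eps_normal.2.
Qed.

Lemma eps_indep i j (A B : set R) : i != j -> measurable A -> measurable B ->
  P (eps i @^-1` A `&` eps j @^-1` B) =
  (P (eps i @^-1` A) * P (eps j @^-1` B))%E.
Proof.
move=> ij mA mB.
(* Mutual independence is used with the index set [{i, j}] and the family equal to [A] at [i] and
   [B] elsewhere. *)
have := eps_normal.1 [set i; j]%SET (fun k => if k == i then A else B).
rewrite big_setU1 ?inE//= big_set1 eqxx eq_sym (negbTE ij) => <-; last first.
  by move=> k; case: ifP.
congr (P _); apply/seteqP; split => w /=.
  move=> [wA wB] k /=; rewrite !inE => /orP[/eqP ->|/eqP ->]; first by rewrite eqxx.
  by rewrite eq_sym (negbTE ij).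
move=> h; split.
  by have := h i; rewrite /= !inE !eqxx; apply.
by have := h j; rewrite /= !inE eqxx orbT eq_sym (negbTE ij); apply.
Qed.

Lemma eps_cov i j : has_mean P (fun w => eps i w * eps j w) (s ^+ 2 * (i == j)%:R).
Proof.
split; first by apply: Lfun2_mul_Lfun1; exact: eps_Lfun2.
case: eqVneq => [<-|ij].
  by rewrite mulr1 -(eps_sqr i) unlock; apply: eq_integral => w _; rewrite expr2.
rewrite expectation_mul_indep ?eps_Lfun2//; last by move=> A B; exact: eps_indep.
by have [_ ->] := eps_mean i; rewrite mul0e mulr0.
Qed.

Variables (p : nat) (x : 'I_n -> 'cV[R]_p) (beta : 'cV[R]_p).

Lemma mse_linear h mu :
  mse x beta eps (fun y => dotv h (n%:R^-1 *: \sum_(i < n) y i *: x i)) mu =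
  (s ^+ 2 / n%:R * bilin h (Sigma x) h +
   (dotv h (Sigma x *m beta) - mu) ^+ 2)%:E.
Proof.
rewrite /mse.
(* The error is the bias plus noise with weights [c_i = n^-1 x_i^T h], and
   [\sum_i c_i^2 = n^-1 h^T Sigma h]. *)
have decomp w : dotv h (n%:R^-1 *: \sum_(i < n) response x beta eps w i *: x i) - mu =
    (dotv h (Sigma x *m beta) - mu) + \sum_i (n%:R^-1 * dotv (x i) h) * eps i w.
  rewrite addrAC; congr (_ - _).
  rewrite dotvZr dotv_sumr -/(bilin h (Sigma x) beta) bilin_Sigma.
  rewrite !mulr_sumr -big_split/=; apply: eq_bigr => i _.
  by rewrite dotvZr /response (dotvC h); ring.
under eq_fun do rewrite decomp.
rewrite (second_moment_affine _ _ eps_mean eps_cov) addrC; congr (_ + _)%:E.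
rewrite bilin_Sigma !mulr_sumr; apply: eq_bigr => i _.
by rewrite exprMn expr2; ring.
Qed.

Hypothesis Sigma_unit : Sigma x \in unitmx.

(** Here [h = Sigma^-1 x0], so [Sigma h = x0] and the bias vanishes. *)
Lemma mse_wideE x0 : mse_wide x beta eps x0 =
  (s ^+ 2 / n%:R * bilin x0 (invmx (Sigma x)) x0)%:E.
Proof.
have tr_inv : (invmx (Sigma x))^T = invmx (Sigma x) by rewrite trmx_inv tr_Sigma.
rewrite /mse_wide.
have -> : mu_wide x x0 = fun y =>
    dotv (invmx (Sigma x) *m x0) (n%:R^-1 *: \sum_(i < n) y i *: x i).
  by apply/funext => y; rewrite /mu_wide /beta_wide dotv_mulmxr tr_inv.
rewrite mse_linear /bilin mulKVmx// !dotv_mulmxl tr_inv mulKmx//.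
by rewrite subrr expr0n addr0.
Qed.

Lemma dotv_subv S (u v : 'cV[R]_p) :
  dotv u v = dotv (subv S u) (subv S v) + dotv (subv (~: S) u) (subv (~: S) v).
Proof. by rewrite {1}(sel_subv S v) dotvDr !dotv_mulmxr !subvE. Qed.

(** Here [h] is [g = Sigma00^-1 x_{0,S}] padded with zeros. In the bias [g^T (Sigma00 beta_S +
    Sigma01 beta_{S^c}) - x0^T beta] the [beta_S] terms cancel. *)
Lemma mse_subE S x0 : mse_sub x beta eps S x0 =
  (s ^+ 2 / n%:R * bilin (subv S x0) (invmx (Sigma00 x S)) (subv S x0) +
   dotv (omega x S x0) (subv (~: S) beta) ^+ 2)%:E.
Proof.
have B_unit := Sigma00_unit Sigma_unit S.
have tr_inv : (invmx (Sigma00 x S))^T = invmx (Sigma00 x S).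
  by rewrite trmx_inv tr_Sigma00.
rewrite /mse_sub; set g := invmx (Sigma00 x S) *m subv S x0.
have -> : mu_hat x S x0 = fun y =>
    dotv (sel S *m g) (n%:R^-1 *: \sum_(i < n) y i *: x i).
  apply/funext => y; rewrite /mu_hat /beta_hat dotv_mulmxr tr_inv -/g.
  rewrite dotv_mulmxl -scalemxAr mulmx_sumr; congr (dotv _ (_ *: _)).
  by apply: eq_bigr => i _; rewrite -scalemxAr subvE.
rewrite mse_linear; congr (_ * _ + _ ^+ 2)%:E.
  by rewrite /bilin dotv_mulmxl -subvE subv_mul_sel -/(Sigma00 x S) mulKVmx// dotvC.
rewrite dotv_mulmxl -subvE {1}(sel_subv S beta) mulmxDr subvD !subv_mul_sel.
rewrite -/(Sigma00 x S) -/(Sigma01 x S) dotvDr {1}/g dotv_mulmxl tr_inv mulKmx//.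
rewrite (dotv_subv S x0 beta) /omega dotvBl -mulmxA -/g dotv_mulmxl /Sigma10 trmxK.
by rewrite opprD addrACA subrr add0r.
Qed.

End NormalErrors.

Theorem mainTheorem2 (R : realType) (d : measure_display)
    (T : measurableType d) (P : probability T R) (n p : nat)
    (x : 'I_n -> 'cV[R]_p) (beta x0 : 'cV[R]_p) (sigma : R)
    (eps : 'I_n -> {RV P >-> R}) (S : {set 'I_p})
    (p_ge1 : (1 <= p)%N) (n_ge_p : (p <= n)%N)
    (Sigma_full_rank : \rank (Sigma x) = p)
    (sigma_gt0 : 0 < sigma)
    (eps_normal : iid_normal 0 sigma eps)
    (x0_neq0 : x0 != 0) :
  let wide := bilin x0 (invmx (Sigma x)) x0 in
  let sub := bilin (subv S x0) (invmx (Sigma00 x S)) (subv S x0) in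
  let lam := lambda x S x0 beta sigma in
  let kap := kappa x S x0 beta sigma in
  let om := omega x S x0 in
  let omQom := bilin om (Q x S) om in
  let mseS := mse_sub x beta eps S x0 in
  let mseW := mse_wide x beta eps x0 in
  let rrS := rr x beta eps S x0 in
  [/\ rrS = ((sub + n%:R * lam ^+ 2) / wide)%:E,
      (mseS < mseW)%E <->
        `|lam| < Num.sqrt (wide - sub) / Num.sqrt n%:R,
      Num.sqrt (wide - sub) / Num.sqrt n%:R
        = Num.sqrt omQom / Num.sqrt n%:R &
      om != 0 ->
        rrS = ((sub + omQom * kap ^+ 2) / wide)%:E /\
        (sub + omQom * kap ^+ 2) / wide
          = 1 - omQom / wide * (1 - kap ^+ 2)].
Proof.
move=> wide sub lam kap om omQom mseS mseW rrS.
have Sigma_unit : Sigma x \in unitmx by rewrite -row_free_unit /row_free Sigma_full_rank.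
have n_gt0 : (0 < n)%N by exact: leq_trans n_ge_p.
have n0 : 0 < n%:R :> R by rewrite ltr0n.
have wide_gt0 : 0 < wide by exact: bilin_wide_gt0.
have q_ge0 : 0 <= omQom by exact: bilin_Q_omega_ge0.
have wideE : wide - sub = omQom.
  by rewrite /wide (bilin_wide Sigma_unit S) -/sub addrC addKr.
have [s0 w0 nn0] : [/\ sigma != 0, wide != 0 & n%:R != 0 :> R] by rewrite !gt_eqF.
have mseWE : mseW = (sigma ^+ 2 / n%:R * wide)%:E by exact: mse_wideE.
have mseSE : mseS = (sigma ^+ 2 / n%:R * (sub + n%:R * lam ^+ 2))%:E.
  rewrite /mseS (mse_subE sigma_gt0)//; congr (_%:E); rewrite /lam /lambda -/sub -/om.
  by field; rewrite s0 nn0.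
have c_gt0 : 0 < sigma ^+ 2 / n%:R by rewrite divr_gt0// exprn_gt0.
have rrE : rrS = ((sub + n%:R * lam ^+ 2) / wide)%:E.
  (* The inverse in [\bar R] is the real one only away from 0, which holds as the wide risk is
     positive. *)
  rewrite /rrS /rr -/mseS -/mseW mseSE mseWE inver mulf_eq0 !gt_eqF//= -EFinM.
  by congr (_%:E); field; rewrite w0 s0 nn0.
split => //; last move=> om_neq0.
- rewrite mseSE mseWE lte_fin ltr_pM2l// -ltrBrDl wideE.
  have -> // : (`|lam| < Num.sqrt omQom / Num.sqrt n%:R) = (n%:R * lam ^+ 2 < omQom).
  (* Multiply by [sqrt n] and square: both sides are nonnegative, and [omQom >= 0] lets its root be
     squared away. *)
  rewrite ltr_pdivlMr ?sqrtr_gt0// -(@ltr_pXn2r _ 2)// ?nnegrE ?mulr_ge0 ?sqrtr_ge0//.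
  by rewrite exprMn -normrX ger0_norm ?sqr_ge0// !sqr_sqrtr ?ler0n// mulrC.
- by rewrite wideE.
have q_gt0 : 0 < omQom by exact: bilin_Q_omega_gt0.
(* For [omQom > 0] the square root in [kappa] cancels, so both [kappa] formulas reduce to the one in
   [lambda]. *)
have kapE : omQom * kap ^+ 2 = n%:R * lam ^+ 2.
  rewrite /kap /kappa -/om -/omQom /lam /lambda -/om.
  rewrite !exprMn !exprVn exprMn !sqr_sqrtr ?ltW//.
  by field; rewrite s0 gt_eqF.
rewrite kapE rrE; split=> //.
rewrite mulrBr mulr1 mulrAC kapE -wideE.
by field.
Qed.
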